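(* Let $\Lambda$ be a finite $k$-graph without sources or sinks. Let $\mathcal{C}$ be the set of nontrivial strongly connected components of $\Lambda^0$, and suppose that $\Lambda_C$ is coordinatewise irreducible for each $C\in\mathcal{C}$. Then the vertex set $\Lambda^0$ can be ordered in such a way that (simultaneously, for the same ordering) each vertex matrix $A_j$, $1\le j\le k$, is block upper triangular with the diagonal blocks being the vertex matrices $\{A_{C,j}:C\in\mathcal{C}\}$ and some strictly upper triangular matrices.
   Context: A $k$-graph is a countable category $\Lambda$ with a functor $d:\Lambda\to\mathbb{N}^k$ such that whenever $d(\lambda)=n+p$ there are unique $\mu,\nu\in\Lambda$ with $d(\mu)=n$, $d(\nu)=p$ and $\lambda=\mu\nu$. Write $\Lambda^n=d^{-1}(n)$; $\Lambda^0$ is identified with the set of objects (vertices), and $r,s:\Lambda\to\Lambda^0$ are the codomain and domain maps. For sets (or elements) $X,Y\subset\Lambda^0$, $X\Lambda^nY=\{\lambda\in\Lambda^n:r(\lambda)\in X,\ s(\lambda)\in Y\}$ and $X\Lambda Y=\bigcup_nX\Lambda^nY$. Let $e_1,\dots,e_k$ be the usual basis of $\mathbb{N}^k$. $\Lambda$ is finite if every $\Lambda^n$ is finite; it has no sources or sinks (in the strong sense) if $v\Lambda^n\ne\emptyset$ and $\Lambda^nv\neq\emptyset$ for all $v\in\Lambda^0$, $n\in\mathbb{N}^k$. The vertex matrices are the $\Lambda^0\times\Lambda^0$ matrices $A_i(v,w)=|v\Lambda^{e_i}w|$. Write $v\le w$ if $v\Lambda w\neq\emptyset$; strongly connected components are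 the classes of the equivalence relation $v\le w\le v$; a component $\{v\}$ with $v\Lambda v=\{v\}$ is trivial, and all others are nontrivial. For a component $C$, $\Lambda_C:=C\Lambda C$ is a $k$-graph with vertex matrices $A_{C,i}=(A_i(v,w))_{v,w\in C}$; it is coordinatewise irreducible if every $A_{C,i}$, $1\le i\le k$, is irreducible (a matrix $A$ is irreducible if for all $(v,w)$ there is $m$ with $A^m(v,w)\ne0$). *)

(* Defs.v *)
From HB Require Import structures.
From mathcomp Require Import all_boot all_order all_algebra finmap.
From mathcomp Require Import boolp classical_sets functions cardinality.

Set Implicit Arguments.
Unset Strict Implicit.
Unset Printing Implicit Defensive.

Import GRing.Theory.
Local Open Scope classical_set_scope.
Local Open Scope ring_scope.

Notation degree k := {ffun 'I_k -> nat}.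

Definition basis_degree (k : nat) (i : 'I_k) : degree k :=
  [ffun j => (j == i) : nat].

(* [hom v w] is the set of paths with range [v] and source [w], so that
   [path_mul m n], for [m : hom u v] and [n : hom v w], is the composite written
   [m n]. Countability of the category is carried by the [countType]s. *)
Record kgraph (k : nat) := KGraph {
  vertex : countType;
  hom : vertex -> vertex -> countType;
  path_id : forall v, hom v v;
  path_mul : forall u v w, hom u v -> hom v w -> hom u w;
  deg : forall v w, hom v w -> degree k;
  path_mul_idl : forall v w (l : hom v w), path_mul (path_id v) l = l;
  path_mul_idr : forall v w (l : hom v w), path_mul l (path_id w) = l;
  path_mulA : forall t u v w (l : hom t u) (m : hom u v) (n : hom v w),
    path_mul l (path_mul m n) = path_mul (path_mul l m) n;
  deg_id : forall v, deg (path_id v) = 0;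
  deg_mul : forall u v w (m : hom u v) (n : hom v w),
    deg (path_mul m n) = deg m + deg n;
  factorization : forall v w (l : hom v w) (n p : degree k),
    deg l = n + p ->
    exists! f : {u : vertex & (hom v u * hom u w)%type},
      [/\ deg (tagged f).1 = n, deg (tagged f).2 = p
        & path_mul (tagged f).1 (tagged f).2 = l]
}.

Arguments hom {k} _ _ _.
Arguments path_id {k} _ _.
Arguments path_mul {k _ u v w} _ _.
Arguments deg {k _ v w} _.

Section KGraphs.
Context {k : nat}.
Implicit Type L : kgraph k.

Definition kpath L : Type :=
  {vw : vertex L * vertex L & hom L vw.1 vw.2}.

Definition finite_kgraph L : Prop :=
  forall n : degree k, finite_set [set l : kpath L | deg (tagged l) = n].

Definition no_sources L : Prop :=
  forall (v : vertex L) (n : degree k),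
    exists w, exists l : hom L v w, deg l = n.

Definition no_sinks L : Prop :=
  forall (v : vertex L) (n : degree k),
    exists u, exists l : hom L u v, deg l = n.

(* The number |v L^{e_i} w|. [fset_set] of an infinite set is empty, so this is
   meaningful only when that set is finite, e.g. in a finite k-graph. *)
Definition adjacency L (i : 'I_k) (v w : vertex L) : nat :=
  #|` fset_set [set l : hom L v w | deg l = basis_degree i]|%fset.

(* MathComp matrices are indexed by ordinals: the vertex matrix is taken along a
   listing [e] of vertices. An ordering of the vertex set is a bijective [e]. *)
Definition vertex_matrix L (i : 'I_k) (n : nat) (e : 'I_n -> vertex L) :
  'M[nat]_n := \matrix_(a, b) adjacency i (e a) (e b).

(* As [m = 0] is allowed, the 1 x 1 zero matrix is irreducible. *)
Definition irreducible_matrix (n : nat) (A : 'M[nat]_n) : Prop :=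
  forall a b, exists m : nat, (A ^+ m) a b != 0.

(* Meaningful when there are finitely many vertices. *)
Definition vertex_seq L : seq (vertex L) := fset_set [set: vertex L].

(* Irreducibility does not depend on the ordering of the index set, so the
   canonical listing of the vertices is used. *)
Definition coordinatewise_irreducible L : Prop :=
  forall i : 'I_k,
    irreducible_matrix (vertex_matrix i (tnth (in_tuple (vertex_seq L)))).

Definition reaches L (v w : vertex L) : Prop := inhabited (hom L v w).

Definition is_component L (C : set (vertex L)) : Prop :=
  exists v, C = [set w | reaches v w /\ reaches w v].

Definition trivial_component L (C : set (vertex L)) : Prop :=
  exists v, C = [set v] /\ forall l : hom L v v, l = path_id L v.

Definition nontrivial_component L (C : set (vertex L)) : Prop :=
  is_component C /\ ~ trivial_component C.

Lemma component_convex L (C : set (vertex L)) : is_component C ->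
  forall v u w, v \in C -> w \in C -> hom L v u -> hom L u w -> u \in C.
Proof.
move=> [x ->] v u w; rewrite !inE /= => -[[xv] _] [_ [wx]] vu uw.
by split; constructor; [exact: path_mul xv vu | exact: path_mul uw wx].
Qed.

Section ComponentGraph.
Variables (L : kgraph k) (C : set (vertex L)) (hC : is_component C).

Let V : countType := {v : vertex L | v \in C}.
Let homC (v w : V) : countType := hom L (val v) (val w).

Lemma component_factorization (v w : V) (l : homC v w) (n p : degree k) :
  deg l = n + p ->
  exists! f : {u : V & (homC v u * homC u w)%type},
    [/\ deg (tagged f).1 = n, deg (tagged f).2 = p
      & path_mul (tagged f).1 (tagged f).2 = l].
Proof.
pose T (u : vertex L) := (hom L (val v) u * hom L u (val w))%type.
pose lift (y : {u : vertex L & T u}) (h : tag y \in C) :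
    {u : V & (homC v u * homC u w)%type} :=
  existT (fun u : V => (homC v u * homC u w)%type)
    (exist _ (tag y) h) (tagged y).
move=> /factorization[y [y_fact y_uniq]].
have yC : tag y \in C :=
  component_convex hC (valP v) (valP w) (tagged y).1 (tagged y).2.
exists (lift y yC); split=> // -[[u uC] f] f_fact.
have eq_y : y = existT T u f by exact: y_uniq.
suff E z (e : y = z) (zC : tag z \in C) : lift y yC = lift z zC by exact: E eq_y uC.
by case: _ / e zC => zC; rewrite (bool_irrelevance yC zC).
Qed.

(* The k-graph C L C. *)
Definition component_graph : kgraph k := {|
  vertex := V;
  hom := homC;
  path_id := fun v => path_id L (val v);
  path_mul := fun u v w m n => path_mul m n;
  deg := fun v w l => deg l;
  path_mul_idl := fun v w l => path_mul_idl l;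
  path_mul_idr := fun v w l => path_mul_idr l;
  path_mulA := fun t u v w l m n => path_mulA l m n;
  deg_id := fun v => deg_id (val v);
  deg_mul := fun u v w m n => deg_mul m n;
  factorization := component_factorization
|}.

Lemma component_adjacency (i : 'I_k) (v w : vertex component_graph) :
  adjacency i v w = adjacency i (sval v) (sval w).
Proof. by []. Qed.

End ComponentGraph.

Definition strictly_upper_triangular (n : nat) (A : 'M[nat]_n) : Prop :=
  forall a b : 'I_n, (b <= a)%N -> A a b = 0.

Definition block_upper_triangular (m : nat) (p : 'I_m -> nat)
    (A : 'M[nat]_(\sum_i p i)%N) : Prop :=
  forall a b : 'I_m, (b < a)%N -> submxblock A a b = 0.

(* Along the listing [e] of the vertices of [L], cut into consecutive blocks of
   sizes [p], the [a]-th block of vertices lists exactly the component [C], and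
   every [a]-th diagonal block is the vertex matrix of [C L C] for the induced
   listing [c] of [C]. *)
Definition is_component_block L (m : nat) (p : 'I_m -> nat)
    (e : 'I_(\sum_i p i)%N -> vertex L)
    (C : set (vertex L)) (hC : is_component C) (a : 'I_m) : Prop :=
  exists c : 'I_(p a) -> vertex (component_graph hC),
    [/\ bijective c,
        forall x, sval (c x) = e (tagnat.Rank a x)
      & forall j, submxblock (vertex_matrix j e) a a = vertex_matrix j c].

End KGraphs.

(* Main.v *)
Require Import Defs.
From mathcomp Require Import all_boot all_order all_algebra finmap.
From mathcomp Require Import boolp classical_sets functions cardinality.

(** A nonzero entry [A_j(v, w)] provides a path from [w] to [v], so it forces
    [v <= w] in the reachability preorder, whatever [j] is. Hence one listing
    of the strongly connected components that never puts a component after one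
    that it precedes strictly makes all the vertex matrices block upper
    triangular at once. A finite preorder has such a listing of its classes
    ([preorder_class_listing]); concatenating the vertices of the successive
    classes gives the ordering of the vertex set.

    The diagonal block at a component [C] has the entries [A_j(v, w)] with [v]
    and [w] in [C], and these are the entries of the vertex matrix of [C L C].
    If [C = {v}] is trivial, the only path from [v] to [v] has degree [0], not
    [e_j], so the block is the [1 x 1] zero matrix, which is strictly upper
    triangular. *)

Import GRing.Theory.
Local Open Scope classical_set_scope.
Local Open Scope ring_scope.

Set Implicit Arguments.
Unset Strict Implicit.
Unset Printing Implicit Defensive.

(** Topological sorting up to equivalence. The single condition that no element
    of [R] lies above a later one says both that representatives of the same
    class are not repeated and that the classes come in a compatible order.
    To insert a new class [x], it suffices to move the elements below [x] to
    its left and all others to its right: an element of the right part is never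
    below one of the left part, as it would then be below [x]. *)
Lemma preorder_class_listing (T : eqType) (r : rel T) (s : seq T) :
  reflexive r -> transitive r ->
  exists R : seq T,
    pairwise (fun x y => ~~ r y x) R /\
    {in s, forall v, has (fun x => r x v && r v x) R}.
Proof.
move=> r_refl r_trans; elim: s => [|x s [R [R_sorted R_covers]]].
  by exists [::].
have [x_covered|/hasPn x_new] := boolP (has (fun y => r y x && r x y) R).
  by exists R; split=> // v /[!inE] /predU1P[->|/R_covers].
exists ([seq y <- R | r y x] ++ x :: [seq y <- R | ~~ r y x]); split; last first.
  move=> v /[!inE]; rewrite has_cat /= => /predU1P[->|/R_covers/hasP[y yR yv]].
    by rewrite r_refl orbT.
  have [yx|yx] := boolP (r y x); apply/orP; [left|right].
    by apply/hasP; exists y; rewrite // mem_filter yx.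
  by apply/orP; right; apply/hasP; exists y; rewrite // mem_filter yx.
rewrite pairwise_cat /= !pairwise_filter // allrel_consr -andbA.
apply/and4P; split=> //.
- apply/allP=> y; rewrite mem_filter => /andP[yx yR].
  by have := x_new y yR; rewrite yx.
- apply/allrelP=> y z; rewrite !mem_filter => /andP[yx _] /andP[zx _].
  by apply: contra zx => zy; exact: r_trans zy yx.
- by rewrite filter_all.
Qed.

Lemma inj_surj_bij (A B : Type) (f : A -> B) :
  injective f -> (forall b, exists a, f a = b) -> bijective f.
Proof.
move=> f_inj /choice[g fgK].
by exists g => //; exact: inj_can_sym fgK f_inj.
Qed.

Section KGraphLemmas.
Context {k : nat}.
Implicit Type L : kgraph k.

Lemma reaches_refl L (v : vertex L) : reaches v v.
Proof. by constructor; exact: path_id. Qed.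

Lemma reaches_trans L (u v w : vertex L) :
  reaches u v -> reaches v w -> reaches u w.
Proof. by move=> [l] [l']; constructor; exact: path_mul l l'. Qed.

(** The vertices inject into the paths of degree [0], as identities. *)
Lemma finite_vertices L : finite_kgraph L -> finite_set [set: vertex L].
Proof.
move=> /(_ 0) /(finite_image (fun l : kpath L => (tag l).1)).
apply: sub_finite_set => v _; exists (existT _ (v, v) (path_id L v)) => //=.
exact: deg_id.
Qed.

Lemma adjacency_eq0 L (i : 'I_k) (v w : vertex L) :
  (forall l : Defs.hom L v w, deg l <> basis_degree i) -> adjacency i v w = 0%N.
Proof.
move=> no_edge; rewrite /adjacency.
suff -> : [set l : Defs.hom L v w | deg l = basis_degree i] = set0.
  by rewrite fset_set0 cardfs0.
by rewrite -subset0 => l /no_edge.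
Qed.

Lemma basis_degree_neq0 (i : 'I_k) : basis_degree i <> 0.
Proof. by move=> /ffunP/(_ i); rewrite !ffunE eqxx. Qed.

(** The listing of [C] is [e] itself, with values regarded as vertices of
    [C L C]; the matrices agree because [C L C] keeps every path of [L] between
    two vertices of [C]. *)
Lemma component_block_of_vertices L (m : nat) (p : 'I_m -> nat)
    (e : 'I_(\sum_i p i)%N -> vertex L)
    (C : set (vertex L)) (hC : is_component C) (a : 'I_m) :
  injective e ->
  (forall v, C v <-> exists x : 'I_(p a), e (tagnat.Rank a x) = v) ->
  is_component_block e hC a.
Proof.
move=> e_inj C_block.
have inC x : e (tagnat.Rank a x) \in C by rewrite inE; apply/C_block; exists x.
exists (fun x => exist _ (e (tagnat.Rank a x)) (inC x)); split=> //.
  apply: inj_surj_bij => [x y [/e_inj/tagnat.rank_inj]|[v vC]].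
    by move=> /eqP; rewrite eq_Tagged => /eqP.
  have [x ex] := (C_block v).1 (set_mem vC).
  by exists x; exact: val_inj.
by move=> j; apply/matrixP => x y; rewrite !mxE component_adjacency.
Qed.

(** A vertex of [C] listed in block [a] is also listed in block [b], and [e]
    lists it only once. *)
Lemma component_block_uniq L (m : nat) (p : 'I_m -> nat)
    (e : 'I_(\sum_i p i)%N -> vertex L)
    (C : set (vertex L)) (hC : is_component C) (a b : 'I_m) :
  injective e -> (0 < p a)%N ->
  is_component_block e hC a -> is_component_block e hC b -> a = b.
Proof.
move=> e_inj pa_gt0 [c [_ c_e _]] [c' [[g _ c'K] c'_e _]].
have := c'_e (g (c (Ordinal pa_gt0))); rewrite c'K c_e.
move=> /e_inj/tagnat.rank_inj eq_ab.
by have := congr1 (@projT1 _ _) eq_ab.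
Qed.

End KGraphLemmas.

Unset Implicit Arguments.

Theorem proposition3p1 (k : nat) (L : kgraph k)
  (L_finite : finite_kgraph L)
  (L_no_sources : no_sources L)
  (L_no_sinks : no_sinks L)
  (L_irr : forall (C : set (vertex L)) (hC : nontrivial_component C),
     coordinatewise_irreducible (component_graph (proj1 hC))) :
  exists (m : nat) (p : 'I_m -> nat) (e : 'I_(\sum_i p i)%N -> vertex L),
    [/\ bijective e,
        forall a, (0 < p a)%N,
        forall j : 'I_k, block_upper_triangular (vertex_matrix j e),
        forall (C : set (vertex L)) (hC : nontrivial_component C),
          exists! a, is_component_block e (proj1 hC) a
      & forall a,
          (exists (C : set (vertex L)) (hC : nontrivial_component C),
             is_component_block e (proj1 hC) a) \/
          (forall j : 'I_k,
             strictly_upper_triangular (submxblock (vertex_matrix j e) a a))].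
Proof.
pose r (v w : vertex L) := `[< reaches v w >].
have r_refl : reflexive r by move=> v; apply/asboolP; exact: reaches_refl.
have r_trans : transitive r.
  move=> v u w /asboolP uv /asboolP vw.
  by apply/asboolP; exact: reaches_trans uv vw.
pose s := vertex_seq L.
have s_full v : v \in s.
  by rewrite in_fset_set ?inE//; exact: finite_vertices.
have [R [R_sorted R_covers]] := preorder_class_listing s r_refl r_trans.
pose rep (a : 'I_(size R)) := tnth (in_tuple R) a.
have rep_sorted (a b : 'I_(size R)) : (a < b)%N -> ~~ r (rep b) (rep a).
  move=> ab; rewrite /rep !(tnth_nth (rep a)) /=.
  exact: (pairwiseP _ R_sorted) (ltn_ord a) (ltn_ord b) ab.
have rep_covers v : exists a, r (rep a) v && r v (rep a).
  have /hasP[x xR xv] := R_covers v (s_full v).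
  have /tnthP[a ax] : x \in in_tuple R by [].
  by exists a; rewrite /rep -ax.
pose blk a := [seq w <- s | r (rep a) w && r w (rep a)].
have mem_blk a w : (w \in blk a) = r (rep a) w && r w (rep a).
  by rewrite mem_filter s_full andbT.
have blk_uniq a : uniq (blk a) by rewrite filter_uniq // fset_uniq.
pose p a := size (blk a).
pose F (u : {a : 'I_(size R) & 'I_(p a)}) :=
  tnth (in_tuple (blk (tag u))) (tagged u).
pose e (x : 'I_(\sum_i p i)%N) := F (tagnat.sig x).
have e_Rank a x : e (tagnat.Rank a x) = tnth (in_tuple (blk a)) x.
  by rewrite /e tagnat.rankK.
have F_inj : injective F.
  move=> [a x] [b y]; rewrite /F /= => Fxy.
  have := mem_tnth x (in_tuple (blk a)); rewrite mem_blk => /andP[ax xa].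
  have := mem_tnth y (in_tuple (blk b)).
  rewrite -Fxy mem_blk => /andP[bx xb].
  (* [rep a] and [rep b] reach each other through the common vertex, so neither
     may strictly precede the other in [R]. *)
  have eq_ab : a = b.
    apply/val_inj; case: (ltngtP a b) => // /rep_sorted /negP[].
      exact: r_trans bx xa.
    exact: r_trans ax xb.
  case: _ / eq_ab y Fxy {bx xb} => y /tuple_uniqP xy.
  by rewrite (xy (blk_uniq a)).
have e_bij : bijective e.
  apply: inj_surj_bij => [|v].
    exact: inj_comp F_inj (@tagnat.sig_inj _ _).
  have [a] := rep_covers v; rewrite -mem_blk => /(@tnthP _ _ (in_tuple _))[x vx].
  by exists (tagnat.Rank a x); rewrite e_Rank.
have e_inj := bij_inj e_bij.
have p_gt0 a : (0 < p a)%N.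
  have : rep a \in blk a by rewrite mem_blk r_refl.
  by rewrite /p; case: (blk a).
have blk_component C (hC : is_component C) a :
    C (rep a) -> is_component_block e hC a.
  move=> Ca; apply: component_block_of_vertices => // v.
  transitivity (v \in blk a).
    rewrite mem_blk; case: hC Ca => x -> /= [xa ax].
    split=> [[xv vx]|/andP[/asboolP av /asboolP va]].
      by apply/andP; split; apply/asboolP; [exact: reaches_trans ax xv
                                           |exact: reaches_trans vx xa].
    by split; [exact: reaches_trans xa av|exact: reaches_trans va ax].
  split=> [/(@tnthP _ _ (in_tuple _))[x ->]|[x <-]]; rewrite ?e_Rank.
    by exists x.
  exact: (mem_tnth x (in_tuple (blk a))).
exists (size R), p, e; split=> //.
- move=> j a b ba; apply/matrixP => x y; rewrite !mxE !e_Rank.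
  apply: adjacency_eq0 => l _.
  have := mem_tnth x (in_tuple (blk a)); rewrite mem_blk => /andP[ax _].
  have := mem_tnth y (in_tuple (blk b)); rewrite mem_blk => /andP[_ yb].
  have xy : r (tnth (in_tuple (blk a)) x) (tnth (in_tuple (blk b)) y).
    by apply/asboolP; constructor.
  by have /negP[] := rep_sorted _ _ ba; exact: r_trans (r_trans _ _ _ ax xy) yb.
- move=> C [hC C_nontriv] /=.
  have [v Cv] := hC.
  have [a /andP[/asboolP av /asboolP va]] := rep_covers v.
  have block_a : is_component_block e hC a by apply: blk_component; rewrite Cv.
  exists a; split=> // b; exact: component_block_uniq.
- move=> a; pose C := [set w | reaches (rep a) w /\ reaches w (rep a)].
  have hC : is_component C by exists (rep a).
  have Ca : C (rep a) by split; exact: reaches_refl.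
  have [[v [C_v v_id]]|C_nontriv] := pselect (trivial_component C); last first.
    by left; exists C, (conj hC C_nontriv); exact: blk_component.
  (* Here every vertex of block [a] is [v], so all entries are [A_j(v, v) = 0]. *)
  have eq_v x : e (tagnat.Rank a x) = v.
    have := mem_tnth x (in_tuple (blk a)).
    rewrite -e_Rank mem_blk => /andP[/asboolP ax /asboolP xa].
    have : C (e (tagnat.Rank a x)) by [].
    by rewrite C_v.
  right=> j x y _; rewrite !mxE !eq_v; apply: adjacency_eq0 => l.
  by rewrite (v_id l) deg_id => /esym/basis_degree_neq0.
Qed.
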